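(* Let $V$ be a vertex algebra, let $g$ be an automorphism of $V$ with period $T$, and let $W$ be a $g$-twisted $V$-module. If $W=C_2^T(W)$, then $$E_n^T(W)=C_{n+2}^T(W)=W\quad\text{for all } n\ge0.$$
   Context: Vertex algebras are over $\mathbb{C}$; a vertex algebra $V$ has vertex operators $Y(v,x)=\sum_{n\in\mathbb{Z}}v_nx^{-n-1}$ ($v_n\in\mathrm{End}\,V$) and vacuum $\mathbf{1}$. An automorphism of $V$ is a linear isomorphism $g$ with $gY(v,x)g^{-1}=Y(g(v),x)$ for all $v\in V$; it has period $T$ ($T$ a positive integer) if $g^T=1$. Then $V=\bigoplus_{r=0}^{T-1}V^r$ with $V^r=\{v\in V: g(v)=e^{2\pi i r/T}v\}$. A $g$-twisted $V$-module is a vector space $W$ with a linear map $Y_W(\cdot,x):V\to(\mathrm{End}\,W)[[x^{1/T},x^{-1/T}]]$, $Y_W(v,x)=\sum_{n\in\frac1T\mathbb{Z}}v_nx^{-n-1}$, such that for $u\in V^r$ ($0\le r\le T-1$), $v\in V$, $w\in W$: $Y_W(u,x)=\sum_{n\in\frac rT+\mathbb{Z}}u_nx^{-n-1}$; $u_nw=0$ for $n\in\frac rT+\mathbb{Z}$ sufficiently large; $Y_W(\mathbf{1},x)=\mathrm{Id}_W$; and $$x_0^{-1}\delta\left(\tfrac{x_1-x_2}{x_0}\right)Y_W(u,x_1)Y_W(v,x_2)w-x_0^{-1}\delta\left(\tfrac{x_2-x_1}{-x_0}\right)Y_W(v,x_2)Y_W(u,x_1)w=x_2^{-1}\left(\tfrac{x_1-x_0}{x_2}\right)^{-\frac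 rT}\delta\left(\tfrac{x_1-x_0}{x_2}\right)Y_W(Y(u,x_0)v,x_2)w,$$ where $\delta(x)=\sum_{n\in\mathbb{Z}}x^n$ and binomials are expanded in nonnegative integral powers of the second variable. $E_n^T(W)$ ($n\in\mathbb{Z}$) is the linear span of all $u^{(1)}_{-1-k_1+\frac{r_1}{T}}\cdots u^{(s)}_{-1-k_s+\frac{r_s}{T}}w$ with $s\ge1$, $u^{(i)}\in V^{r_i}$, $0\le r_i\le T-1$, $w\in W$, $k_i\ge0$, $k_1+\cdots+k_s-\frac{r_1+\cdots+r_s}{T}\ge\frac nT$. For $n\ge2$, $C_n^T(W)=\mathrm{span}\{u_{-n+\frac pT}w: u\in V^p,\ w\in W,\ p=0,1,\dots,T-1\}$. *)

(* Defs.v *)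
From HB Require Import structures.
From mathcomp Require Import all_boot all_order all_algebra.
From mathcomp Require Import complex.
From mathcomp Require Import all_classical all_reals all_analysis.

Set Implicit Arguments.
Unset Strict Implicit.
Unset Printing Implicit Defensive.

Import Order.TTheory GRing.Theory Num.Theory.

Local Open Scope classical_set_scope.
Local Open Scope ring_scope.

Section GeneralNotions.
Variable F : fieldType.

(* s (s - 1) ... (s - i + 1) / i! *)
Definition gbinom (s : F) (i : nat) : F :=
  (\prod_(j < i) (s - j%:R)) / (i`!)%:R.

Definition lspan (W : lmodType F) (S : set W) : set W :=
  [set w | exists s : seq (F * W),
     (forall p, p \in s -> S p.2) /\ w = \sum_(p <- s) p.1 *: p.2].

(* A formal series sum_(n in (1/T)Z) v_n x^(-n-1) is given by its modes, and
   v_n is indexed by the integer q = n T: [YW v q] is v_(q/T).  In particular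
   T = 1 gives the usual indexing of series with integral exponents.

   [jacobi T r Y YW u v w] is the twisted Jacobi identity, read off as equality
   of the coefficients of x0^(-l-1) x1^(-m-1) x2^(-n-1) on both sides, for l in
   Z, m = a + r/T with a in Z, and n = b/T with b in Z:
     sum_i (-1)^i C(l, i) u_(m+l-i) v_(n+i) w
       - sum_i (-1)^(l+i) C(l, i) v_(n+l-i) u_(m+i) w
     = sum_i (-1)^i C(i - m - 1, i) (u_(l+i) v)_(m+n-i) w.
   On the right, (x1 - x0)^s x2^(-s-1) contributes through s = i - m - 1, which
   ranges over -r/T + Z.  For m outside r/T + Z all three coefficients vanish,
   provided that u only has modes in r/T + Z.  For r = 0 and T = 1 this is the
   Jacobi identity of vertex algebras.

   [\sum_(i \in A)] is the sum of a finitely supported family; the truncation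
   conditions in the structures below make the three families so. *)
Definition jacobi (V W : lmodType F) (T r : nat)
    (Y : V -> int -> V -> V) (YW : V -> int -> W -> W)
    (u v : V) (w : W) : Prop :=
  forall l a b : int,
  let m : int := a * T%:Z + r%:Z in
    \sum_(i \in [set: nat])
       ((-1) ^+ i * gbinom l%:~R i) *:
         YW u (m + (l - i%:Z) * T%:Z) (YW v (b + i%:Z * T%:Z) w)
  - \sum_(i \in [set: nat])
       ((-1) ^ (l + i%:Z) * gbinom l%:~R i) *:
         YW v (b + (l - i%:Z) * T%:Z) (YW u (m + i%:Z * T%:Z) w)
  = \sum_(i \in [set: nat])
       ((-1) ^+ i * gbinom (i%:R - (a%:~R + r%:R / T%:R) - 1) i) *:
         YW (Y u (l + i%:Z) v) (m + b - i%:Z * T%:Z) w.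

End GeneralNotions.

Section VertexAlgebras.
Variable R : realType.

(* [Y v n] is the mode v_n. *)
Record vertexAlgebra (V : lmodType R[i]) := VertexAlgebra {
  va_op :> V -> int -> V -> V;
  vacuum : V;
  va_linear_mode : forall v n, linear (va_op v n);
  va_linear : forall n w, linear (fun v => va_op v n w);
  va_truncation : forall u v,
    exists N : int, forall n : int, N <= n -> va_op u n v = 0;
  va_vacuum : forall n v, va_op vacuum n v = if n == -1 then v else 0;
  va_creation : forall v,
    va_op v (-1) vacuum = v /\ forall n : int, 0 <= n -> va_op v n vacuum = 0;
  va_jacobi : forall u v w, jacobi 1 0 va_op va_op u v w
}.

Definition va_automorphism (V : lmodType R[i]) (Y : vertexAlgebra V)
    (g : V -> V) : Prop :=
  [/\ linear g, bijective g & forall v n u, g (Y v n u) = Y (g v) n (g u)].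

Definition has_period (V : Type) (g : V -> V) (T : nat) : Prop :=
  (0 < T)%N /\ iter T g =1 id.

(* exp (2 pi i r / T) *)
Definition expi_frac (T r : nat) : R[i] :=
  Complex (cos (2 * pi * r%:R / T%:R)) (sin (2 * pi * r%:R / T%:R)).

Definition graded_part (V : lmodType R[i]) (g : V -> V) (T r : nat) : set V :=
  [set v | g v = expi_frac T r *: v].

(* As above, [YW v q] is v_(q/T); so q = - T is the mode of index -1, and the
   modes with index in r/T + Z are those with q = r modulo T. *)
Record twistedModule (V : lmodType R[i]) (Y : vertexAlgebra V) (g : V -> V)
    (T : nat) (W : lmodType R[i]) := TwistedModule {
  tm_op :> V -> int -> W -> W;
  tm_linear_mode : forall v q, linear (tm_op v q);
  tm_linear : forall q w, linear (fun v => tm_op v q w);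
  tm_support : forall (r : nat) u (q : int) w, (r < T)%N ->
    graded_part g T r u -> (q != r%:Z %[mod T%:Z])%Z -> tm_op u q w = 0;
  tm_truncation : forall (r : nat) u w, (r < T)%N -> graded_part g T r u ->
    exists N : int, forall q : int,
      N <= q -> (q == r%:Z %[mod T%:Z])%Z -> tm_op u q w = 0;
  tm_vacuum : forall q w,
    tm_op (vacuum Y) q w = if q == - T%:Z then w else 0;
  tm_jacobi : forall (r : nat) u v w, (r < T)%N -> graded_part g T r u ->
    jacobi T r Y tm_op u v w
}.

Section Filtrations.
Variables (V : lmodType R[i]) (Y : vertexAlgebra V) (g : V -> V) (T : nat).
Variables (W : lmodType R[i]) (YW : twistedModule Y g T W).

(* A triple (u, r, k) stands for the operator u_(-1-k+r/T). *)
Definition tm_factor (f : V * nat * nat) : W -> W :=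
  let: (u, r, k) := f in YW u ((- 1 - k%:Z) * T%:Z + r%:Z).

Definition E_gen (n : int) : set W :=
  [set x | exists (fs : seq (V * nat * nat)) (w : W),
    [/\ (0 < size fs)%N,
        forall u r k, (u, r, k) \in fs -> (r < T)%N /\ graded_part g T r u,
        n%:~R / T%:R <= (\sum_(f <- fs) f.2)%:R
                        - (\sum_(f <- fs) f.1.2)%:R / T%:R :> rat
      & x = foldr tm_factor w fs]].

Definition E_T (n : int) : set W := lspan (E_gen n).

(* Only meant for n >= 2. *)
Definition C_T (n : nat) : set W :=
  lspan [set x | exists (p : nat) (u : V) (w : W),
    [/\ (p < T)%N, graded_part g T p u
      & x = YW u (- n%:Z * T%:Z + p%:Z) w]].

End Filtrations.
End VertexAlgebras.

(* Main.v *)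
Require Import Defs.
From mathcomp Require Import all_boot all_order all_algebra.
From mathcomp Require Import complex.
From mathcomp Require Import all_classical all_reals all_analysis.
From mathcomp Require Import zify ring.

(* Iterating W = C_2 writes every vector through arbitrarily long products of
   modes u_(-2+r/T), so W = E_n.

   For W = C_n the inductive step from n to n + 1 compares coefficients in the
   Jacobi identity at l = -1: modulo C_(n+1), u_(-n+r/T) v_(-n+s/T) w is, up to
   a nonzero factor, a combination of the (u_(-1+i) v)_(1-2n-i+(r+s)/T) w.
   These lie in C_(n+1), except possibly for n = 2, i = 0 and r + s >= T, where
   one gets (u_(-1) v)_(-2+p/T) w with p = r + s - T < r; so a strong induction
   on r concludes. *)

Import Order.TTheory GRing.Theory Num.Theory.
Local Open Scope classical_set_scope.
Local Open Scope ring_scope.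

Lemma fsum_ord {V : nmodType} N (f : nat -> V) :
    (forall i, (N <= i)%N -> f i = 0) ->
  \sum_(i \in [set: nat]) f i = \sum_(i < N) f i.
Proof.
move=> f0; rewrite fsbig_ord; apply/esym/fsbig_widen => // i [_ /= /negP].
by rewrite -leqNgt => /f0.
Qed.

(** * Linear spans *)

Section Span.
Context {F : fieldType} {W : lmodType F}.
Implicit Types (S : set W) (x y : W).

Lemma sub_lspan S x : S x -> lspan S x.
Proof.
move=> Sx; exists [:: (1, x)]; split; last by rewrite big_seq1 scale1r.
by move=> p; rewrite inE => /eqP ->.
Qed.

Lemma lspan0 S : lspan S 0.
Proof. by exists [::]; split=> //; rewrite big_nil. Qed.

Lemma lspanD S x y : lspan S x -> lspan S y -> lspan S (x + y).
Proof.
move=> [s [Ss ->]] [t [St ->]]; exists (s ++ t); split; last by rewrite big_cat.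
by move=> p; rewrite mem_cat => /orP[/Ss|/St].
Qed.

Lemma lspanZ S c x : lspan S x -> lspan S (c *: x).
Proof.
move=> [s [Ss ->]]; exists [seq (c * p.1, p.2) | p <- s]; split.
  by move=> _ /mapP[p /Ss Sp ->].
by rewrite big_map scaler_sumr; apply: eq_bigr => p _; rewrite scalerA.
Qed.

Lemma lspanB S x y : lspan S x -> lspan S y -> lspan S (x - y).
Proof. by move=> Sx Sy; rewrite -scaleN1r; apply/lspanD/lspanZ. Qed.

Lemma lspan_sum S (I : Type) (r : seq I) (P : pred I) (f : I -> W) :
  (forall i, P i -> lspan S (f i)) -> lspan S (\sum_(i <- r | P i) f i).
Proof.
by move=> Sf; apply: big_ind => //; [exact: lspan0 | exact: lspanD].
Qed.

(** Membership is to be tested on generators only. Taking [f] to be the identity gives inclusions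
    between spans. *)
Lemma lspan_linear {U : lmodType F} (S : set U) (S' : set W) (f : U -> W) :
    linear f -> (forall u, S u -> lspan S' (f u)) ->
  forall u, lspan S u -> lspan S' (f u).
Proof.
move=> lin_f Sf _ [s [Ss ->]]; elim: s Ss => [_|p s IHs Ss].
  rewrite big_nil -(scale0r (0 : U)) (scalable_linear lin_f) /= scale0r.
  exact: lspan0.
rewrite big_cons lin_f; apply: lspanD.
  by apply/lspanZ/Sf/Ss; rewrite inE eqxx.
by apply: IHs => q sq; apply: Ss; rewrite inE sq orbT.
Qed.

End Span.

(** * Generalized binomial coefficients *)

Section Gbinom.
Variable F : fieldType.

Lemma gbinom0 (s : F) : gbinom s 0 = 1.
Proof. by rewrite /gbinom big_ord0 divr1. Qed.

Lemma gbinom1 (s : F) : gbinom s 1 = s.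
Proof. by rewrite /gbinom big_ord1 subr0 divr1. Qed.

Lemma gbinom0n i : gbinom (0 : F) i.+1 = 0.
Proof. by rewrite /gbinom big_ord_recl /= subr0 !mul0r. Qed.

End Gbinom.

(** The factors are -1, ..., -i, all nonzero in characteristic 0. This allows solving the Jacobi
    identity at l = -1 for any term of its first sum. *)
Lemma gbinomN1_neq0 (F : numFieldType) i : gbinom (-1 : F) i != 0.
Proof.
rewrite /gbinom mulf_neq0 ?invr_eq0 ?pnatr_eq0 -?lt0n ?fact_gt0 //.
by apply/prodf_neq0 => j _; rewrite -opprD oppr_eq0 -(natrD _ 1) pnatr_eq0.
Qed.

(** * Eigenspaces of the automorphism *)

Section Grading.
Context {R : realType}.

Lemma expi_fracD T r s :
  expi_frac R T (r + s) = expi_frac R T r * expi_frac R T s.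
Proof.
rewrite /expi_frac natrD mulrDr mulrDl cosD sinD.
by rewrite [X in Complex _ X]addrC.
Qed.

Lemma expi_fracT T : (0 < T)%N -> expi_frac R T T = 1.
Proof.
move=> T0; rewrite /expi_frac -mulrA divff ?pnatr_eq0 -?lt0n // mulr1.
by rewrite mulr_natl cos2pi sin2pi.
Qed.

Context {V : lmodType R[i]} {Y : vertexAlgebra V} {g : V -> V} {T : nat}.
Hypothesis T_gt0 : (0 < T)%N.

Lemma graded_partT r : graded_part g T (T + r) = graded_part g T r.
Proof. by rewrite /graded_part expi_fracD expi_fracT // mul1r. Qed.

Hypothesis g_aut : va_automorphism Y g.

(** For the product [Y u (-1) v], the image of the vacuum is a left identity because [g] is onto,
    and the vacuum is a right identity; hence the two agree. *)
Lemma graded_vacuum : graded_part g T 0 (vacuum Y).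
Proof.
have [_ [h _ gK] gY] := g_aut.
have gvac v : Y (g (vacuum Y)) (-1) v = v.
  by rewrite -{1}(gK v) -gY va_vacuum eqxx gK.
rewrite /graded_part /= /expi_frac mulr0 mul0r cos0 sin0 scale1r.
by rewrite -{2}(gvac (vacuum Y)) (va_creation _ _).1.
Qed.

Lemma graded_op r s u v n : graded_part g T r u -> graded_part g T s v ->
  graded_part g T (r + s) (Y u n v).
Proof.
have [_ _ gY] := g_aut; rewrite /graded_part /= => gu gv.
rewrite gY gu gv expi_fracD (scalable_linear (va_linear Y _ _)).
by rewrite (scalable_linear (va_linear_mode Y _ _)) /= scalerA.
Qed.

(** * Modes on a twisted module and the subspaces they span *)

Context {W : lmodType R[i]} (YW : twistedModule Y g T W).

Lemma tm_op0 u q : YW u q 0 = 0.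
Proof.
rewrite -[X in YW _ _ X](scale0r (0 : W)).
by rewrite (scalable_linear (tm_linear_mode YW u q)) /= scale0r.
Qed.

Lemma tm_op0l q w : YW 0 q w = 0.
Proof.
rewrite -(scale0r (0 : V)) (scalable_linear (tm_linear YW q w)) /=.
exact: scale0r.
Qed.

(* The L(-1)-derivative property: [Y u (-2) 1] is L(-1) u. *)
Lemma tm_derivative r u (a : int) w : (r < T)%N -> graded_part g T r u ->
  YW (Y u (-2) (vacuum Y)) (a * T%:Z + r%:Z) w =
    - ((a%:~R + r%:R / T%:R) *: YW u ((a - 1) * T%:Z + r%:Z) w).
Proof.
(* At l = -2 and n = 0 the vacuum occurs on the left only with indices i and -2 - i, never -1, so
   the left side vanishes. On the right only i = 0 and i = 1 survive, by the creation property. *)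
move=> rT gu; have := tm_jacobi YW (vacuum Y) w rT gu (-2) a 0; cbv zeta.
rewrite fsbig1 => [|i _]; last first.
  by rewrite tm_vacuum ifF ?tm_op0 ?scaler0 //; apply/negP => /eqP; nia.
rewrite fsbig1 => [|i _]; last first.
  by rewrite tm_vacuum ifF ?scaler0 //; apply/negP => /eqP; nia.
rewrite (@fsum_ord _ 2) => [|i i2]; last first.
  by rewrite (va_creation _ _).2 ?tm_op0l ?scaler0 //; lia.
rewrite subr0 big_ord_recr big_ord1 /= gbinom0 gbinom1 expr0 expr1 mulr1.
rewrite scale1r !addr0 => /esym/eqP; rewrite addr_eq0 => /eqP ->.
rewrite (va_creation _ _).1.
by congr (- (_ *: YW u _ w)); ring.
Qed.

(** This is the Jacobi identity at l = 0, where C(0, i) = 0 for i > 0. *)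
Lemma tm_commutator r s u v (a b : int) w :
    (r < T)%N -> graded_part g T r u ->
  YW u (a * T%:Z + r%:Z) (YW v (b * T%:Z + s%:Z) w) =
  YW v (b * T%:Z + s%:Z) (YW u (a * T%:Z + r%:Z) w) +
  \sum_(i \in [set: nat])
    ((-1) ^+ i * gbinom (i%:R - (a%:~R + r%:R / T%:R) - 1) i) *:
      YW (Y u i%:Z v) ((a + b - i%:Z) * T%:Z + (r + s)%:Z) w.
Proof.
move=> rT gu; have := tm_jacobi YW v w rT gu 0 a (b * T%:Z + s%:Z).
cbv zeta; rewrite (@fsum_ord _ 1) => [|[|i] // _]; last first.
  by rewrite gbinom0n mulr0 scale0r.
rewrite (@fsum_ord _ 1) => [|[|i] // _]; last first.
  by rewrite gbinom0n mulr0 scale0r.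
rewrite !big_ord1 /= gbinom0 expr0 !mulr1 !addr0 !scale1r.
move/eqP; rewrite subr_eq [X in _ == X]addrC => /eqP ->; congr (_ + _).
apply: eq_fsbigr => i _; rewrite add0r PoszD; congr (_ *: YW _ _ w); ring.
Qed.

(** By the derivative property, u_(m-1+r/T) is a multiple of (L(-1) u)_(m+r/T), so the index can be
    lowered one step at a time, with [u] varying in the induction. *)
Lemma C_T_mode n r u (a : int) w : (0 < n)%N -> (r < T)%N ->
  graded_part g T r u -> a <= - n%:Z ->
  C_T YW n (YW u (a * T%:Z + r%:Z) w).
Proof.
move=> n_gt0 rT + an; have -> : a = - n%:Z - (absz (a + n%:Z))%:Z by lia.
elim: (absz _) u => [|k IHk] u gu.
  by apply: sub_lspan; exists r, u, w; rewrite subr0.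
have gDu : graded_part g T r (Y u (-2) (vacuum Y)).
  by rewrite -[r]addn0; apply: graded_op => //; exact: graded_vacuum.
set m : int := - n%:Z - k%:Z in IHk.
(* Here m <= -1 while r/T < 1. *)
have m_neq0 : m%:~R + r%:R / T%:R != 0 :> R[i].
  have T_neq0 : T%:R != 0 :> R[i] by rewrite pnatr_eq0 -lt0n.
  rewrite -(inj_eq (mulIf T_neq0)) mul0r mulrDl divfK //.
  rewrite -[r%:R]/(r%:Z%:~R) -[T%:R]/(T%:Z%:~R).
  by rewrite -intrM -intrD intr_eq0 /m; nia.
have := IHk _ gDu; rewrite tm_derivative // -scaleNr.
move=> /(lspanZ _ (- (m%:~R + r%:R / T%:R))^-1 _).
rewrite scalerA mulVf ?oppr_eq0 // scale1r.
by congr (C_T YW n (YW u (_ * _ + _) w)); rewrite /m; lia.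
Qed.

(** If r + s >= T, the residue is r + s - T and the integer part of the index becomes a + 1; hence
    the stronger bound. *)
Lemma C_T_mode_carry n r s u (a : int) w : (0 < n)%N ->
  (r < T)%N -> (s < T)%N -> graded_part g T (r + s) u -> a + 1 <= - n%:Z ->
  C_T YW n (YW u (a * T%:Z + (r + s)%:Z) w).
Proof.
move=> n_gt0 rT sT gu an; have [rsT|Trs] := ltnP (r + s) T.
  by apply: C_T_mode => //; lia.
have rsE : (r + s = T + (r + s - T))%N by lia.
rewrite rsE PoszD addrA -{2}[T%:Z]mul1r -mulrDl.
apply: C_T_mode => //; first lia.
by rewrite -graded_partT -rsE.
Qed.

(** Commute the mode past a generator v_(-n+s/T) w: the swapped product is again a generator, and
    the correction terms have integer part a - n - i <= -n - 1, which leaves room for a carry. *)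
Lemma C_T_op n r u (a : int) x : (0 < n)%N -> (r < T)%N ->
  graded_part g T r u -> a <= -1 -> C_T YW n x ->
  C_T YW n (YW u (a * T%:Z + r%:Z) x).
Proof.
move=> n_gt0 rT gu a_lt0; apply: lspan_linear; first exact: tm_linear_mode.
move=> _ [s [v [w [sT gv ->]]]]; rewrite tm_commutator //.
apply: lspanD; first by apply: C_T_mode.
apply: lspan_sum => i _; apply/lspanZ/C_T_mode_carry => //; last lia.
exact: graded_op.
Qed.

Lemma C_T_mode_succ n r u x : (2 <= n)%N -> C_T YW n = setT ->
  (r < T)%N -> graded_part g T r u ->
  C_T YW n.+1 (YW u (- n%:Z * T%:Z + r%:Z) x).
Proof.
move=> n_ge2 CnT; elim/ltn_ind: r u x => r IHr u x rT gu.
(* As C_n is everything, it suffices to treat x = v_(-n+s/T) w. *)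
have : C_T YW n x by rewrite CnT.
apply: lspan_linear; first exact: tm_linear_mode.
move=> _ [s [v [w [sT gv ->]]]]; rewrite -/(C_T YW n.+1 _).
have [N vN0] := tm_truncation YW w sT gv.
(* From i = K on, v_(1-2n+i+s/T) kills w. *)
pose K := (n + n + absz N)%N.
have nK : (n.-1 < K)%N by rewrite /K; lia.
(* The first sum then consists of the u_(-1-i+r/T) v_(1-2n+i+s/T) w, and its term i = n - 1 is the
   wanted product. *)
have := tm_jacobi YW v w rT gu (-1) 0 ((1 - (n + n)%:Z) * T%:Z + s%:Z).
cbv zeta; rewrite (@fsum_ord _ K) => [|i Ki]; last first.
  rewrite [X in YW u _ X]vN0 ?tm_op0 ?scaler0 //.
    by rewrite /K in Ki; nia.
  by rewrite addrAC -mulrDl modzMDl.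
rewrite (bigD1 (Ordinal nK)) //=.
set lhs := YW u _ (YW v _ w).
have -> : YW u (- n%:Z * T%:Z + r%:Z) (YW v (- n%:Z * T%:Z + s%:Z) w) = lhs.
  by congr (YW u _ (YW v _ w)); nia.
set c := _ * gbinom _ _.
have c_neq0 : c != 0 by rewrite mulf_neq0 ?signr_eq0 ?gbinomN1_neq0.
set A := \sum_(i < K | _) _; set B := \sum_(i \in _) _.
set D := \sum_(i \in _) _.
move/eqP; rewrite subr_eq => /eqP E.
have -> : lhs = c^-1 *: (D + B - A).
  by rewrite -E addrK scalerA mulVf // scale1r.
apply/lspanZ/lspanB; first apply: lspanD.
(* The integer part is 1 - 2n - i, or 2 - 2n - i after a carry. The latter exceeds -n - 1 only for n
   = 2 and i = 0; then the residue r + s - T is less than r and the induction hypothesis applies. *)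
- apply: lspan_sum => i _; apply: lspanZ.
  have guv := graded_op _ _ _ _ (-1 + i%:Z) gu gv.
  have -> : 0 * T%:Z + r%:Z + ((1 - (n + n)%:Z) * T%:Z + s%:Z) - i%:Z * T%:Z =
    (1 - (n + n + i)%:Z) * T%:Z + (r + s)%:Z by lia.
  have [rsT|Trs] := ltnP (r + s) T; first by apply: C_T_mode => //; lia.
  have [in_gt|] := boolP (0 < i + (n - 2))%N.
    by apply: C_T_mode_carry => //; lia.
  move=> in_le; have i0 : i = 0%N by lia.
  have n2 : n = 2%N by lia.
  have -> : (1 - (n + n + i)%:Z) * T%:Z + (r + s)%:Z =
    - n%:Z * T%:Z + (r + s - T)%N%:Z by rewrite i0 n2; lia.
  by apply: IHr; [lia | lia | rewrite -graded_partT subnKC].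
(* The outer mode v_(-2n-i+s/T) alone suffices. *)
- apply: lspan_sum => i _; apply: lspanZ.
  have -> : (1 - (n + n)%:Z) * T%:Z + s%:Z + (-1 - i%:Z) * T%:Z =
    (- (n + n + i)%:Z) * T%:Z + s%:Z by lia.
  by apply: C_T_mode => //; lia.
apply: lspan_sum => i; rewrite -val_eqE /= => i_neq; apply: lspanZ.
rewrite mul0r add0r [r%:Z + _]addrC addrAC -mulrDl.
(* For i >= n the outer index is low enough. For i <= n - 2 the inner one is, and the outer mode
   preserves C_(n+1). *)
have [ni|i_lt] := leqP n i; first by apply: C_T_mode => //; lia.
by apply: C_T_op; rewrite //; [lia | apply: C_T_mode => //; lia].
Qed.

Lemma C_T_succ n : (2 <= n)%N -> C_T YW n = setT -> C_T YW n.+1 = setT.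
Proof.
move=> n_ge2 CnT; rewrite -subTset -CnT => x.
apply: (@lspan_linear _ _ _ _ _ id) => {x} // _ [r [u [x [rT gu ->]]]].
exact: C_T_mode_succ.
Qed.

(** A factor u_(-2+r/T) has k = 1 and contributes 1 - r/T >= 1/T, so prepending one raises the level
    by at least one. *)
Lemma E_T_set : C_T YW 2 = setT -> forall n : nat, E_T YW n%:Z = setT.
Proof.
move=> C2T; elim=> [|n IHn]; rewrite -subTset -C2T => x;
  apply: (@lspan_linear _ _ _ _ _ id) => {x} // _ [r [u [x [rT gu ->]]]].
  apply: sub_lspan; exists [:: (u, r, 1%N)], x; split => //=.
  - by move=> ? ? ?; rewrite inE => /eqP[-> -> _].
  - rewrite !big_seq1 mul0r subr_ge0 ler_pdivrMr ?ltr0n // mul1r ler_nat.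
    exact: ltnW.
have : E_T YW n x by rewrite IHn.
apply: lspan_linear; first exact: tm_linear_mode.
move=> _ [fs [w [fs_gt0 gfs nfs ->]]]; apply: sub_lspan.
exists ((u, r, 1%N) :: fs), w; split => //=.
- by move=> u' r' k; rewrite inE => /orP[/eqP[-> -> _]|/gfs].
- move: nfs; rewrite !big_cons /=.
  rewrite !ler_pdivrMr ?ltr0n // !mulrBl !divfK ?pnatr_eq0 -?lt0n //.
  rewrite !lerBrDr -!natrM -!natrD !ler_nat; nia.
Qed.

End Grading.

Theorem lemma6p6 (R : realType) (V : lmodType R[i]) (Y : vertexAlgebra V)
    (g : V -> V) (T : nat) (W : lmodType R[i]) (YW : twistedModule Y g T W) :
  va_automorphism Y g -> has_period g T ->
  [set: W] = C_T YW 2 ->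
  forall n : nat, E_T YW n%:Z = C_T YW n.+2 /\ C_T YW n.+2 = [set: W].
Proof.
move=> g_aut [T_gt0 _] /esym C2T n; have CnT : C_T YW n.+2 = setT.
  by elim: n => // n; exact: C_T_succ.
by split=> //; rewrite E_T_set.
Qed.
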